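(* Let $d\ge 1$, $D=\{1,\dots,d\}$, and let $\mathcal{P}(D)$ be the set of all subsets of $D$ (including $\emptyset$). Let $E=E_1\times\dots\times E_d$ be a product of Polish spaces with its Borel $\sigma$-algebra, $Z$ a Polish space, $G:E\to Z$ a measurable function, and $X\sim P_X$ an $E$-valued random vector. Let $\mathbb{A}$ be a commutative ring with identity and let $\phi_{P_X}(G)\in\mathbb{A}$ be an $\mathbb{A}$-valued quantity of interest on $G$. Let $\varphi:\mathcal{P}(D)\to\mathbb{A}$, $A\mapsto\varphi_A$, be a set function such that $\varphi_A$ is well-defined for every $A\in\mathcal{P}(D)$ and $\varphi_D=\phi_{P_X}(G)$. Then $$\phi_{P_X}(G)=\sum_{A\in\mathcal{P}(D)}\psi_A,$$ where, for every $A\subseteq D$, $$\psi_A=\sum_{B\subseteq A}(-1)^{|A|-|B|}\varphi_B .$$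
   Context: $\mathbb{P}(E)$ denotes the set of Borel probability measures on $E$ and $\mathcal{M}(E)$ the set of measurable functions $E\to Z$ (''models''). An $\mathbb{A}$-valued quantity of interest (QoI) is a map $\phi:\mathbb{P}(E)\times\mathcal{M}(E)\to\mathbb{A}$, $(P,H)\mapsto\phi_P(H)$, evaluated at $(P_X,G)$; it is assumed non-random. $|A|$ denotes the cardinality of $A$. A representation $\phi_{P_X}(G)=\sum_{A\in\mathcal{P}(D)}\psi_A$ with $\psi:\mathcal{P}(D)\to\mathbb{A}$ is called a coalitional decomposition of the QoI, and the particular one in the claim is called a Möbius decomposition. *)

(* Defs.v *)
From HB Require Import structures.
From mathcomp Require Export all_boot all_order all_algebra.
From mathcomp Require Export all_classical all_reals all_analysis.

Set Implicit Arguments.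
Unset Strict Implicit.
Unset Printing Implicit Defensive.

Import Order.TTheory GRing.Theory Num.Theory.
Local Open Scope classical_set_scope.
Local Open Scope ring_scope.

Definition separable (T : topologicalType) : Prop :=
  exists2 S : set T, countable S & dense S.

(* The metric is only required to exist: it lives on a homeomorphic copy M
   of T, so that T itself carries a topology and nothing more. *)
Definition completely_metrizable (R : realType) (T : topologicalType) : Prop :=
  exists (M : metricType R) (f : T -> M) (g : M -> T),
    [/\ cancel f g, cancel g f, continuous f, continuous g &
        forall F : set_system M, ProperFilter F -> cauchy F -> exists l : M, F --> l].

Definition polish (R : realType) (T : topologicalType) : Prop :=
  separable T /\ completely_metrizable R T.

Notation borel T := (g_sigma_algebraType (@open T)).

(* Maps from pairs of a probability measure on E and a model, i.e. a
   measurable function E -> Z, to K. *)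
Definition qoi (R : realType) (dE dZ : measure_display)
    (E : measurableType dE) (Z : measurableType dZ) (K : Type) : Type :=
  probability E R -> {mfun E >-> Z} -> K.

(* The natural number subtraction is exact since B \subset A. *)
Definition mobius (K : comPzRingType) (d : nat) (v : {set 'I_d} -> K)
    (A : {set 'I_d}) : K :=
  \sum_(B : {set 'I_d} | B \subset A) (-1) ^+ (#|A| - #|B|) * v B.

(* Main.v *)
(* After exchanging the two sums, the coefficient of varphi_B is the
   alternating sum over the sets A containing B, which is the expansion of
   the product of (1 + 0) over B and (-1 + 1) over its complement; it thus
   vanishes unless B is the whole set. *)
Require Import Defs.

Set Implicit Arguments.
Unset Strict Implicit.
Unset Printing Implicit Defensive.

Import GRing.Theory.
Local Open Scope ring_scope.

Lemma sum_sign_supersets (K : comPzRingType) (T : finType) (B : {set T}) :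
  \sum_(A : {set T} | B \subset A) (-1) ^+ (#|A| - #|B|) =
    (B == [set: T]%SET)%:R :> K.
Proof.
pose f i : K := if i \in B then 1 else -1.
pose g i : K := (i \notin B)%:R.
transitivity (\prod_(i : T) (f i + g i)); last first.
  have [BT|] := eqVneq B [set: T]%SET.
    by rewrite big1 // => i _; rewrite /f /g BT !inE addr0.
  rewrite -finset.subTset => /subsetPn[x _ xB].
  by rewrite (bigD1 x) //= /f /g (negbTE xB) addNr mul0r.
(* Here [A] collects the indices at which [f] is chosen in the expansion. *)
rewrite bigA_distr big_mkcond; apply: eq_bigr => A _.
(* If [A] misses some [x] in [B], the factor [g x = 0] kills its term. *)
case: ifPn => [BA | /subsetPn[x xB xA]]; last first.
  by rewrite (bigD1 x) //= (negbTE xA) /g xB mul0r.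
(* The sign is a product of -1 over [A :\: B], compared with the expanded term factor by factor. *)
rewrite -cardsDS // -prodr_const big_mkcond; apply: eq_bigr => i _.
rewrite /f /g !inE; case: (boolP (i \in B)) => [/(fintype.subsetP BA) -> //|_].
by case: (i \in A).
Qed.

Lemma sum_mobius (K : comPzRingType) (d : nat) (v : {set 'I_d} -> K) :
  \sum_(A : {set 'I_d}) mobius v A = v [set: 'I_d]%SET.
Proof.
rewrite /mobius (exchange_big_dep predT) //=.
(* [v B] does not depend on [A], so it factors out of the inner sum. *)
under eq_bigr => B _ do rewrite -mulr_suml sum_sign_supersets.
rewrite (bigD1 [set: 'I_d]%SET) //= eqxx mul1r big1 ?addr0 // => B.
by move/negbTE->; rewrite mul0r.
Qed.

Theorem lemma1 (R : realType) (d : nat) (hd : (0 < d)%N)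
    (E : 'I_d -> ptopologicalType) (hE : forall i, polish R (E i))
    (Z : ptopologicalType) (hZ : polish R Z)
    (G : {mfun borel (prod_topology E) >-> borel Z})
    (dO : measure_display) (Omega : measurableType dO)
    (P : probability Omega R) (X : {RV P >-> borel (prod_topology E)})
    (K : comPzRingType) (phi : qoi R (borel (prod_topology E)) (borel Z) K)
    (varphi : {set 'I_d} -> K)
    (hvarphi : varphi [set: 'I_d]%SET = phi (distribution P X) G) :
  phi (distribution P X) G = \sum_(A : {set 'I_d}) mobius varphi A.
Proof. by rewrite sum_mobius hvarphi. Qed.
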